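(* Let $\mathbb{K}$ be a field, let $\{P_\pi\}$ be a deconcatenation basis of $\mathrm{ParQSym}$, and let $Q_\pi\in\mathrm{ParQSym}$ be an element chosen for each partition diagram $\pi$. Suppose there exists a nonsingular function $f:A_{>0}\to\mathbb{K}$ such that for every partition diagram $\pi$ $$Q_\pi=\sum_{\rho:\ \pi\le\rho}f(\pi,\rho)P_\rho.$$ Then $\{Q_\pi\}$ is a deconcatenation basis of $\mathrm{ParQSym}$.
   Context: **Partition diagrams.** A partition diagram of order $k\ge 0$ is a set partition of $\{1,\dots,k,1',\dots,k'\}$; for $k=0$ the only one is the empty diagram $\emptyset$. $A_{>0}$ is the set of all non-empty partition diagrams. For $\pi$ of order $k$ and $\rho$ of order $m$, $\pi\otimes\rho$ is the diagram of order $k+m$ whose blocks are the blocks of $\pi$ and the blocks of $\rho$ with labels shifted by $k$ ($i\mapsto i+k$, $i'\mapsto (i+k)'$). If $k,m\ge1$, $\pi\bullet\rho$ is obtained from $\pi\otimes\rho$ by merging the block containing $k'$ with the block containing $(k+1)'$. The empty diagram is the unit for both operations. A diagram is $\otimes$-irreducible (resp. $\bullet$-irreducible) if it is not $\rho\otimes\sigma$ (resp. $\rho\bullet\sigma$) with $\rho,\sigma$ both non-empty. Every non-empty $\pi$ is uniquely $\pi_1\otimes\cdots\otimes\pi_l$ with all $\pi_i$ non-empty and $\otimes$-irreducible; $l(\pi):=l$, and $l(\emptyset):=0$. **Refinement.** Every non-empty $\pi$ can be uniquely written $\pi=\pi_1\divideontimes_1\pi_2\divideontimes_2\cdots\divideontimes_{n-1}\pi_n$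 with each $\divideontimes_i\in\{\otimes,\bullet\}$ and each $\pi_i$ non-empty and both $\otimes$- and $\bullet$-irreducible (on non-empty diagrams $\otimes$ and $\bullet$ associate with each other). Put $S(\pi)=\{i\in\{1,\dots,n-1\}:\divideontimes_i=\otimes\}$. For non-empty $\pi,\sigma$ write $\pi\sim\sigma$ if their sequences $(\pi_1,\dots,\pi_n)$ and $(\sigma_1,\dots,\sigma_m)$ are equal; $\pi\le\sigma$ if $\pi\sim\sigma$ and $S(\sigma)\subseteq S(\pi)$. The empty diagram is related only to itself, with $\emptyset\le\emptyset$. If $\pi\le\rho$ and $\rho=\rho_1\otimes\cdots\otimes\rho_{l(\rho)}$ with $\rho_i$ non-empty $\otimes$-irreducible, then $\pi$ can be written uniquely as $\pi=\pi_\rho^{(1)}\otimes\cdots\otimes\pi_\rho^{(l(\rho))}$ with $\pi_\rho^{(i)}\le\rho_i$ for each $i$. For $f:A_{>0}\to\mathbb{K}$ and $\pi\le\rho$ define $f(\pi,\rho)=f(\pi_\rho^{(1)})\cdots f(\pi_\rho^{(l(\rho))})$, with $f(\emptyset,\emptyset)=1$. The function $f$ is nonsingular if $f(\pi)\ne0$ for all non-empty $\otimes$-irreducible $\pi$. **ParQSym.** $\mathrm{ParQSym}=\bigoplus_{i\ge0}\mathrm{ParQSym}_i$ where $\mathrm{ParQSym}_i$ has $\mathbb{K}$-basis $\{M_\pi:\pi\text{ of order }i\}$, with coproduct $\Delta M_\sigma=\sum_{\pi\otimes\rho=\sigma}M_\pi\otimes M_\rho$ over all ordered pairs of (possibly empty)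 diagrams. A graded basis $\{X_\pi\}$ (indexed by all partition diagrams, with $\{X_\pi:\pi\text{ of order }i\}$ a basis of $\mathrm{ParQSym}_i$ for each $i$) is a deconcatenation basis if $\Delta(X_\sigma)=\sum_{\pi\otimes\rho=\sigma}X_\pi\otimes X_\rho$ for all partition diagrams $\sigma$. *)

(* Defs.v *)
From HB Require Import structures.
From mathcomp Require Import all_boot all_algebra.
From mathcomp Require Import finmap monalg.
From mathcomp Require Import boolp.
From mathcomp Require classical_sets.

Set Implicit Arguments.
Unset Strict Implicit.
Unset Printing Implicit Defensive.

Import GRing.Theory.
Local Open Scope ring_scope.

(* inl i and inr i stand for the labels i+1 and (i+1)'. *)
Notation label k := ('I_k + 'I_k)%type.

Definition diag (k : nat) :=
  {P : {set {set label k}} | partition P [set: label k]}.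
HB.instance Definition _ k := SubFinite.on (diag k).

Definition pdiag := {k : nat & diag k}.
HB.instance Definition _ := Countable.on pdiag.

Definition pdorder (p : pdiag) : nat := tag p.

Definition mkpd (k : nat) (P : diag k) : pdiag := Tagged diag P.

Lemma empty_subproof : partition set0 [set: label 0].
Proof.
rewrite /partition /cover big_set0 inE andbT; apply/andP; split.
  by apply/eqP/setP => -[[]|[]].
by apply/trivIsetP => A B; rewrite inE.
Qed.

Definition empty_pd : pdiag := @mkpd 0 (Sub set0 empty_subproof).

Section Tensor.
Variables k m : nat.

Definition llab (x : label k) : label (k + m) :=
  match x with inl i => inl (lshift m i) | inr i => inr (lshift m i) end.

Definition rlab (x : label m) : label (k + m) :=
  match x with inl i => inl (rshift k i) | inr i => inr (rshift k i) end.

Definition tens_blocks (P : {set {set label k}}) (Q : {set {set label m}}) :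
    {set {set label (k + m)}} :=
  [set llab @: (B : {set _}) | B in P] :|: [set rlab @: (B : {set _}) | B in Q].

Lemma llab_inj : injective llab.
Proof.
by move=> [i|i] [j|j] //= [] e; congr (_ _); apply/val_inj; case: e.
Qed.

Lemma rlab_inj : injective rlab.
Proof.
by move=> [i|i] [j|j] //= [] /addnI e; congr (_ _); apply/val_inj.
Qed.

Lemma lrlab x y : llab x != rlab y.
Proof.
apply/eqP; case: x y => [i|i] [j|j] //= [] e;
by move: (ltn_ord i); rewrite e ltnNge leq_addr.
Qed.

Lemma tens_subproof (P : diag k) (Q : diag m) :
  partition (tens_blocks (val P) (val Q)) [set: label (k + m)].
Proof.
case: P Q => P /= /and3P[/eqP cP tP nP] [Q /= /and3P[/eqP cQ tQ nQ]].
apply/and3P; split.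
- apply/eqP/setP => x; rewrite inE; apply/bigcupP.
  have [[y ->]|[y ->]] : (exists y, x = llab y) \/ (exists y, x = rlab y).
    by case: x => i; case: (split_ordP i) => j ->;
      [left; exists (inl j)|right; exists (inl j)
      |left; exists (inr j)|right; exists (inr j)].
  + have /bigcupP[B BP yB] : y \in cover P by rewrite cP inE.
    exists (llab @: B); last exact: imset_f.
    by apply/setUP; left; apply/imsetP; exists B.
  + have /bigcupP[B BP yB] : y \in cover Q by rewrite cQ inE.
    exists (rlab @: B); last exact: imset_f.
    by apply/setUP; right; apply/imsetP; exists B.
- have dlr (A : {set label k}) (B : {set label m}) :
      [disjoint llab @: A & rlab @: B].
    apply/pred0P => x /=; apply/negP => /andP[/imsetP[y _ ->] /imsetP[z _ e]].
    by move: (lrlab y z); rewrite e eqxx.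
  apply/trivIsetP => A B; rewrite !inE.
  case/orP => /imsetP[A' hA ->] /orP[] /imsetP[B' hB ->] ne //.
  + rewrite -setI_eq0 -imsetI; last by move=> ? ? _ _; apply: llab_inj.
    rewrite imset_eq0 setI_eq0 (trivIsetP tP) //.
    by apply: contraNneq ne => ->.
  + by rewrite disjoint_sym.
  + rewrite -setI_eq0 -imsetI; last by move=> ? ? _ _; apply: rlab_inj.
    rewrite imset_eq0 setI_eq0 (trivIsetP tQ) //.
    by apply: contraNneq ne => ->.
- rewrite inE negb_or; apply/andP; split.
    by apply/imsetP => -[B BP /eqP]; rewrite eq_sym imset_eq0 => /eqP B0;
      rewrite -B0 BP in nP.
  by apply/imsetP => -[B BQ /eqP]; rewrite eq_sym imset_eq0 => /eqP B0;
    rewrite -B0 BQ in nQ.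
Qed.

Definition tens_diag (P : diag k) (Q : diag m) : diag (k + m) :=
  Sub (tens_blocks (val P) (val Q)) (tens_subproof P Q).

End Tensor.

Section Merge.
Variables (T : finType) (P : {set {set T}}) (a b : T).

Definition merge_blocks : {set {set T}} :=
  (pblock P a :|: pblock P b) |: (P :\ pblock P a :\ pblock P b).

Lemma merge_subproof : partition P [set: T] -> partition merge_blocks [set: T].
Proof.
case/and3P => /eqP cP tP nP.
have aP : pblock P a \in P by rewrite pblock_mem ?cP ?inE.
have bP : pblock P b \in P by rewrite pblock_mem ?cP ?inE.
have dis A : A \in P :\ pblock P a :\ pblock P b ->
    [disjoint pblock P a :|: pblock P b & A].
  rewrite !inE => /and3P[Ab Aa AP].
  rewrite -setI_eq0 setIUl setU_eq0 !setI_eq0.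
  by rewrite !(trivIsetP tP) // eq_sym.
apply/and3P; split.
- apply/eqP/setP => x; rewrite inE; apply/bigcupP.
  have /bigcupP[B BP xB] : x \in cover P by rewrite cP inE.
  have [Ba|nBa] := eqVneq B (pblock P a).
    by exists (pblock P a :|: pblock P b); rewrite !inE ?eqxx // -Ba xB.
  have [Bb|nBb] := eqVneq B (pblock P b).
    by exists (pblock P a :|: pblock P b); rewrite !inE ?eqxx // -Bb xB orbT.
  by exists B => //; rewrite !inE nBa nBb BP orbT.
- apply/trivIsetP => A B /setU1P[->|hA] /setU1P[->|hB].
  + by rewrite eqxx.
  + by move=> _; apply: dis.
  + by move=> _; rewrite disjoint_sym; apply: dis.
  + move: hA hB; rewrite !inE => /and3P[_ _ AP] /and3P[_ _ BP].
    exact: (trivIsetP tP).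
- rewrite !inE (negPf nP) !andbF orbF eq_sym setU_eq0 negb_and.
  by apply/orP; left; apply: contraNneq nP => <-.
Qed.

End Merge.

(* lshift _ ord_max and rshift _ ord0 are the positions k and k + 1. *)
Definition bullet_diag (k m : nat) (P : diag k.+1) (Q : diag m.+1) :
    diag (k.+1 + m.+1) :=
  Sub (merge_blocks (val (tens_diag P Q))
         (inr (lshift m.+1 ord_max)) (inr (rshift k.+1 ord0)))
      (merge_subproof _ _ (valP (tens_diag P Q))).

Definition ptens (p q : pdiag) : pdiag :=
  mkpd (tens_diag (tagged p) (tagged q)).

Definition pbullet (p q : pdiag) : pdiag :=
  match p, q with
  | existT 0 _, _ => q
  | _, existT 0 _ => p
  | existT k.+1 P, existT m.+1 Q => mkpd (bullet_diag P Q)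
  end.

Lemma pdorder_ptens p q : pdorder (ptens p q) = (pdorder p + pdorder q)%N.
Proof. by []. Qed.

Lemma pdorder_pbullet p q : pdorder (pbullet p q) = (pdorder p + pdorder q)%N.
Proof. by case: p q => [[|k] P] [[|m] Q] //=; rewrite /pdorder /= addn0. Qed.

Definition nediag := {p : pdiag | (0 < pdorder p)%N}.
HB.instance Definition _ := SubCountable.on nediag.

Definition tens_irr (p : pdiag) : Prop :=
  forall a b : nediag, p <> ptens (val a) (val b).

Definition bullet_irr (p : pdiag) : Prop :=
  forall a b : nediag, p <> pbullet (val a) (val b).

Definition tens_seq (s : seq nediag) : pdiag :=
  foldr (fun a p => ptens (val a) p) empty_pd s.

Definition is_tens_factorization (p : pdiag) (s : seq nediag) : Prop :=
  (forall a, a \in s -> tens_irr (val a)) /\ p = tens_seq s.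

(* In an operator sequence o : seq bool, true stands for the tensor product
   and false for the bullet product. *)
Definition mixed_prod (a : nediag) (s : seq nediag) (o : seq bool) : pdiag :=
  foldl (fun p x => if x.1 then ptens p (val x.2) else pbullet p (val x.2))
    (val a) (zip o s).

Definition is_mixed_factorization
    (p : pdiag) (a : nediag) (s : seq nediag) (o : seq bool) : Prop :=
  [/\ size s = size o,
      forall b, b \in a :: s -> tens_irr (val b) /\ bullet_irr (val b)
    & p = mixed_prod a s o].

Definition tens_positions (o : seq bool) : pred nat := fun i => nth false o i.

(* The two factorizations have the same irreducible factors a :: s. *)
Definition refines (p q : pdiag) : Prop :=
  (p = empty_pd /\ q = empty_pd) \/
  exists a s o o', [/\ is_mixed_factorization p a s o,
    is_mixed_factorization q a s o'
    & forall i, tens_positions o' i -> tens_positions o i].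

Definition pdle (p q : pdiag) : bool := `[< refines p q >].

Lemma pdorder_mixed_prod a s o : size s = size o ->
  pdorder (mixed_prod a s o) = sumn [seq pdorder (val b) | b <- a :: s].
Proof.
rewrite /mixed_prod; case: a => /= p _.
elim: s o p => [|b s IH] [|c o] p //= => [_|[e]]; first by rewrite addn0.
rewrite IH // addnA; congr (_ + _)%N.
by case: c => /=; rewrite ?pdorder_ptens ?pdorder_pbullet.
Qed.

Lemma pdorder_pdle p q : pdle p q -> pdorder p = pdorder q.
Proof.
move=> /asboolP[[-> ->] //|[a [s [o [o' [[e _ ->] [e' _ ->] _]]]]]].
by rewrite !pdorder_mixed_prod.
Qed.

(* s is the sequence of factors of p induced by r, for p refining r. *)
Definition is_relative_factorization (p r : pdiag) (s : seq nediag) : Prop :=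
  p = tens_seq s /\
  exists rs : seq nediag, is_tens_factorization r rs /\
    all2 (fun a b => pdle (val a) (val b)) s rs.

(* For p <= r such a sequence exists and is unique, so the default value [::]
   plays no role. *)
Definition relative_factors (p r : pdiag) : seq nediag :=
  classical_sets.xget [::] (is_relative_factorization p r).

(* The tensor product of the free modules on S and T, realized as the free module
   on S * T, (a, b) being the tensor product of basis vectors. *)
Definition tensv (K : fieldType) (S T : choiceType)
    (u : {malg K[S]}) (v : {malg K[T]}) : {malg K[(S * T)%type]} :=
  \sum_(a <- msupp u) \sum_(b <- msupp v) << u@_a * v@_b *g (a, b) >>.

Section ParQSym.
Variable K : fieldType.

Definition rel_prod (f : nediag -> K) (p r : pdiag) : K :=
  \prod_(a <- relative_factors p r) f a.

Definition nonsingular (f : nediag -> K) : Prop :=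
  forall a : nediag, tens_irr (val a) -> f a != 0.

(* By pdorder_pdle, all the r with p <= r have the order of p. *)
Definition sum_above (V : nmodType) (p : pdiag) (F : pdiag -> V) : V :=
  \sum_(r : diag (pdorder p) | pdle p (mkpd r)) F (mkpd r).

(* Sum of F a b over all the pairs (a, b) whose tensor product is p; by
   pdorder_ptens the orders of a and b add up to the order of p. *)
Definition sum_split (V : nmodType) (p : pdiag) (F : pdiag -> pdiag -> V) : V :=
  \sum_(i < (pdorder p).+1) \sum_(a : diag i)
    \sum_(b : diag (pdorder p - i) | ptens (mkpd a) (mkpd b) == p)
      F (mkpd a) (mkpd b).

Notation ParQSym := {malg K[pdiag]}.
Notation ParQSym2 := {malg K[(pdiag * pdiag)%type]}.

Definition M (p : pdiag) : ParQSym := << p >>.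

Definition coproduct (u : ParQSym) : ParQSym2 :=
  \sum_(p <- msupp u) u@_p *: sum_split p (fun a b => tensv (M a) (M b)).

Definition homogeneous (i : nat) (u : ParQSym) : Prop :=
  forall p, pdorder p != i -> u@_p = 0.

Definition is_basis_of (I : finType) (V : lmodType K) (U : V -> Prop)
    (x : I -> V) : Prop :=
  [/\ forall i, U (x i),
      forall c : I -> K, \sum_i c i *: x i = 0 -> forall i, c i = 0
    & forall u, U u -> exists c : I -> K, u = \sum_i c i *: x i].

Definition graded_basis (X : pdiag -> ParQSym) : Prop :=
  forall i, is_basis_of (homogeneous i) (fun p : diag i => X (mkpd p)).

Definition deconcatenation_basis (X : pdiag -> ParQSym) : Prop :=
  graded_basis X /\
  forall p, coproduct (X p) = sum_split p (fun a b => tensv (X a) (X b)).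

End ParQSym.

Notation ParQSym K := {malg K[pdiag]}.

(* Main.v *)
(* Cutting a diagram at a position [k] is governed by the blocks meeting both
   sides: the diagram is a tensor product there when no block crosses, and a
   bullet product when exactly one does, joining the labels [k'] and [(k+1)'].
   Whether a position is a cut, and of which kind, can be read off either factor
   of any decomposition, so irreducible factorizations are unique, the two
   products associate, and refinement is a partial order compatible with the
   tensor product: the diagrams below [q (x) r] are the [p1 (x) p2] with
   [p1 <= q] and [p2 <= r]. Hence [f(p, r)] is multiplicative, which gives the
   deconcatenation formula, and the transition matrix from [P] to [Q] is
   triangular with diagonal entries [f(p, p) <> 0], which gives the basis. *)
Require Import Defs.
From mathcomp Require Import all_boot all_algebra.
From mathcomp Require Import finmap monalg.
From mathcomp Require Import boolp zify.
From mathcomp Require classical_sets.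
Import GRing.Theory.
Set Implicit Arguments.
Unset Strict Implicit.
Unset Printing Implicit Defensive.

(** * Positions, and diagrams as relations on them *)

(* [(true, i)] is the label [i+1] and [(false, i)] the label [(i+1)'], whatever the
   order of the diagram. *)
Definition position {k} (u : label k) : bool * nat :=
  match u with inl i => (true, val i) | inr i => (false, val i) end.

Lemma position_inj k : injective (@position k).
Proof. by move=> [i|i] [j|j] //= [] /val_inj ->. Qed.

Lemma position_lt k (u : label k) : (position u).2 < k.
Proof. by case: u => i /=. Qed.

Lemma positionP k (x : bool * nat) : x.2 < k -> {u : label k | x = position u}.
Proof.
case: x => [[] i] /= lt_ik; [by exists (inl (Ordinal lt_ik))|].
by exists (inr (Ordinal lt_ik)).
Qed.

Definition shift k (x : bool * nat) : bool * nat := (x.1, k + x.2).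
Definition unshift k (x : bool * nat) : bool * nat := (x.1, x.2 - k).

Lemma shiftK k : cancel (shift k) (unshift k).
Proof. by case=> b i; rewrite /unshift /= addKn. Qed.

Lemma unshiftK k x : k <= x.2 -> shift k (unshift k x) = x.
Proof. by case: x => b i /= le_ki; rewrite /shift /= subnKC. Qed.

Lemma position_llab k m (u : label k) : position (llab m u) = position u.
Proof. by case: u. Qed.

Lemma position_rlab k m (u : label m) :
  position (rlab k u) = shift k (position u).
Proof. by case: u. Qed.

Lemma diag_partition k (P : diag k) : partition (val P) [set: label k].
Proof. by case: P. Qed.

Definition blocks (p : pdiag) : {set {set label (pdorder p)}} :=
  val (tagged p : diag (pdorder p)).

Lemma blocks_partition p : partition (blocks p) [set: label (pdorder p)].
Proof. exact: diag_partition. Qed.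

(** The equivalence relation of the partition, taken on untyped positions so that diagrams of
    different orders are compared without casts. It is false as soon as one position lies outside
    the diagram. *)
Definition same_block (p : pdiag) (x y : bool * nat) : bool :=
  [exists B in blocks p, exists u in B, exists v in B,
    (x == position u) && (y == position v)].

Lemma same_blockP p x y :
  reflect (exists B u v, [/\ B \in blocks p, u \in B, v \in B,
                            x = position u & y = position v])
          (same_block p x y).
Proof.
apply: (iffP exists_inP) => [[B hB /exists_inP[u hu /exists_inP[v hv]]]|].
  by case/andP=> /eqP -> /eqP ->; exists B, u, v.
case=> B [u [v [hB hu hv -> ->]]]; exists B => //; apply/exists_inP.
by exists u => //; apply/exists_inP; exists v; rewrite ?eqxx.
Qed.

Lemma same_block_lt p x y :
  same_block p x y -> x.2 < pdorder p /\ y.2 < pdorder p.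
Proof. by case/same_blockP=> B [u [v [_ _ _ -> ->]]]; rewrite !position_lt. Qed.

Lemma same_block_position k (P : diag k) u v :
  same_block (mkpd P) (position u) (position v) = (v \in pblock (val P) u).
Proof.
have /and3P[/eqP cP tP _] := diag_partition P.
apply/same_blockP/idP => [[B [u' [v' [hB hu hv]]]]|hv].
  by move=> /position_inj-> /position_inj->; rewrite (def_pblock tP hB hu).
exists (pblock (val P) u), u, v.
by split=> //; rewrite ?mem_pblock ?pblock_mem ?cP ?inE.
Qed.

Lemma same_block_refl p x : x.2 < pdorder p -> same_block p x x.
Proof.
case: p => k P /positionP[u ->]; rewrite same_block_position mem_pblock.
by have /and3P[/eqP -> _ _] := diag_partition P; rewrite inE.
Qed.

Lemma same_block_sym p x y : same_block p x y = same_block p y x.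
Proof.
by apply/same_blockP/same_blockP => -[B [u [v [hB hu hv -> ->]]]];
  exists B, v, u.
Qed.

Lemma same_block_trans p : transitive (same_block p).
Proof.
move=> y x z /same_blockP[B [u [v [hB hu hv -> ->]]]].
case/same_blockP=> C [v' [w [hC hv' hw /position_inj ev ->]]].
subst v'; apply/same_blockP; exists C, u, w; split=> //.
have /and3P[_ tP _] := blocks_partition p.
by rewrite -(def_pblock tP hC hv') (def_pblock tP hB hv).
Qed.

(** A partition is the set of classes of its own relation. Equalities of diagrams below are reduced
    to this criterion, which avoids transport along equalities of orders. *)
Lemma pdiag_eq p q : pdorder p = pdorder q ->
  same_block p =2 same_block q -> p = q.
Proof.
case: p q => k P [m Q]; rewrite /pdorder /= => e; subst m => epq.
congr (existT _ _ _); apply/val_inj.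
have part (A : diag k) : val A =
    equivalence_partition (fun u v => v \in pblock (val A) u) [set: label k].
  by rewrite equivalence_partition_pblock //; apply: diag_partition.
rewrite (part P) (part Q); apply: eq_in_imset => u _; apply/setP => v.
by rewrite !inE -!same_block_position; apply: epq.
Qed.

(** * The relation of a product *)

Lemma same_block_ptens p q x y :
  same_block (ptens p q) x y =
  same_block p x y || [&& pdorder p <= x.2, pdorder p <= y.2 &
    same_block q (unshift (pdorder p) x) (unshift (pdorder p) y)].
Proof.
case: p q => k P [m Q]; rewrite [pdorder _]/=.
apply/same_blockP/orP => [[B [u [v [hB]]]]|[]].
- case/setUP: hB => /imsetP[B' hB' ->] /imsetP[u' hu ->] /imsetP[v' hv ->] -> ->.
    by left; apply/same_blockP; exists B', u', v'; rewrite !position_llab.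
  right; rewrite !position_rlab !shiftK !leq_addr /=.
  by apply/same_blockP; exists B', u', v'.
- case/same_blockP=> B [u [v [hB hu hv -> ->]]].
  exists (llab m @: B), (llab m u), (llab m v); rewrite !position_llab.
  by split=> //; rewrite ?imset_f // inE imset_f.
- case/and3P=> lex ley /same_blockP[B [u [v [hB hu hv ex ey]]]].
  exists (@rlab k m @: B), (rlab k u), (rlab k v); rewrite !position_rlab.
  rewrite -ex -ey !unshiftK //; split; rewrite ?imset_f //.
  by apply/setUP; right; apply: (imset_f (fun C : {set _} => @rlab k m @: C)).
Qed.

(** With [k] the order of [p], [near z] says that [z] lies in the block of [k'] or in that of
    [(k+1)'], whose zero-based indices are [k.-1] and [k]; the merged block is the union of these
    two. *)
Lemma same_block_pbullet p q x y : 0 < pdorder p -> 0 < pdorder q ->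
  let near z := same_block (ptens p q) z (false, (pdorder p).-1)
    || same_block (ptens p q) z (false, pdorder p) in
  same_block (pbullet p q) x y =
    same_block (ptens p q) x y || near x && near y.
Proof.
case: p q => [[//|k] P] [[//|m] Q] _ _ near.
set a : label (k.+1 + m.+1) := inr (lshift m.+1 ord_max).
set b : label (k.+1 + m.+1) := inr (rshift k.+1 ord0).
have ea : (false, (pdorder (existT diag k.+1 P)).-1) = position a by [].
have eb : (false, pdorder (existT diag k.+1 P)) = position b.
  by rewrite /position /= addn0.
rewrite {}/near ea eb; clear ea eb.
have -> : ptens (existT diag k.+1 P) (existT diag m.+1 Q)
  = mkpd (tens_diag P Q) by [].
set T := tens_diag P Q; rewrite /pbullet.
have /and3P[/eqP cT tT nT] := diag_partition T.
have nearE u c : same_block (mkpd T) (position u) (position c)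
    = (u \in pblock (val T) c).
  by rewrite same_block_sym same_block_position.
have blocksE C : (C \in blocks (mkpd (bullet_diag P Q))) =
    (C \in merge_blocks (val T) a b) by [].
apply/same_blockP/orP => [[B [u [v []]]]|[]]; rewrite ?blocksE.
- case/setU1P=> [->|hB]; rewrite ?inE => hu hv -> ->.
    by right; rewrite !nearE hu hv.
  left; apply/same_blockP; exists B, u, v; split=> //.
  by move: hB; rewrite !inE => /and3P[].
- case/same_blockP=> B [u [v [hB hu hv -> ->]]].
  (* A block of the tensor product is either one of the two being merged, hence contained in their
     union, or survives unchanged. *)
  have [hm|hm] := boolP ((B == pblock (val T) a) || (B == pblock (val T) b)).
    exists (pblock (val T) a :|: pblock (val T) b), u, v.
    rewrite blocksE !inE eqxx; split=> //.
      by case/orP: hm => /eqP <-; rewrite hu ?orbT.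
    by case/orP: hm => /eqP <-; rewrite hv ?orbT.
  exists B, u, v; rewrite blocksE; split=> //; case/norP: hm => na nb.
  by apply/setU1P; right; apply/setD1P; split=> //; apply/setD1P.
- case/andP=> hx hy.
  have /positionP[u ex] : x.2 < k.+1 + m.+1.
    by case/orP: hx => /same_block_lt[].
  have /positionP[v ey] : y.2 < k.+1 + m.+1.
    by case/orP: hy => /same_block_lt[].
  subst x y; exists (pblock (val T) a :|: pblock (val T) b), u, v.
  by move: hx hy; rewrite !nearE blocksE !inE eqxx; split.
Qed.

(** * Restriction to a window of consecutive indices *)

(* The disjunct [u == v] makes this an equivalence even when the window overruns
   the diagram. *)
Definition slice_rel p i m : rel (label m) := fun u v =>
  (u == v) || same_block p (shift i (position u)) (shift i (position v)).

Lemma slice_rel_equiv p i m :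
  {in [set: label m] & &, equivalence_rel (@slice_rel p i m)}.
Proof.
move=> u v w _ _ _; split=> [|/predU1P[-> //|huv]]; rewrite /slice_rel.
  by rewrite eqxx.
have [<-|_] := eqVneq u w.
  by rewrite eq_sym same_block_sym huv orbT.
have [<-|_] /= := eqVneq v w; first by rewrite huv.
by apply/idP/idP; apply: same_block_trans => //; rewrite same_block_sym.
Qed.

(** The restriction of [p] to the indices from [i] to [i + m - 1], renumbered from 0. *)
Definition slice p i m : pdiag :=
  @mkpd m (Sub (equivalence_partition (@slice_rel p i m) [set: label m])
               (equivalence_partitionP (@slice_rel_equiv p i m))).

Lemma same_block_slice p i m x y : i + m <= pdorder p ->
  same_block (slice p i m) x y =
  [&& x.2 < m, y.2 < m & same_block p (shift i x) (shift i y)].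
Proof.
move=> le_im; have [/positionP[u ->]|ge_x] := ltnP x.2 m; last first.
  by apply/negbTE/negP => /same_block_lt[]; rewrite ltnNge ge_x.
have [/positionP[v ->]|ge_y] := ltnP y.2 m; last first.
  by apply/negbTE/negP => /same_block_lt[_]; rewrite ltnNge ge_y.
rewrite same_block_position [X in pblock X]/=.
rewrite (pblock_equivalence_partition (@slice_rel_equiv p i m)) ?inE //=.
rewrite /slice_rel; have [<-/=|//] := eqVneq u v; rewrite same_block_refl //=.
by apply: leq_trans le_im; rewrite ltn_add2l position_lt.
Qed.

(** * Products correspond to cuts *)

Definition op (o : bool) (p q : pdiag) : pdiag :=
  if o then ptens p q else pbullet p q.

Lemma pdorder_op o p q : pdorder (op o p q) = pdorder p + pdorder q.
Proof. by case: o; [rewrite pdorder_ptens|rewrite pdorder_pbullet]. Qed.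

Lemma slice_slice p i m j l : i + m <= pdorder p -> j + l <= m ->
  slice (slice p i m) j l = slice p (i + j) l.
Proof.
move=> im jl; apply: pdiag_eq => // x y.
rewrite !same_block_slice //; last by lia.
have [xl|//] := ltnP x.2 l; have [yl|//] := ltnP y.2 l.
rewrite /= /shift /= !addnA.
have -> : j + x.2 < m by apply: leq_trans jl; rewrite ltn_add2l.
by have -> : j + y.2 < m by apply: leq_trans jl; rewrite ltn_add2l.
Qed.

Lemma slice_full p : slice p 0 (pdorder p) = p.
Proof.
apply: pdiag_eq => // x y; rewrite same_block_slice // /shift /= !add0n.
rewrite -!surjective_pairing; apply/and3P/idP => [[]//|h].
by case/same_block_lt: (h).
Qed.

(** For [false], [k'] and [(k+1)'] are joined and every block crossing position [k] contains
    [(k+1)'], so exactly one block crosses. The condition [0 < k] keeps [k.-1] from being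
    truncated. *)
Definition cut (o : bool) (k : nat) (p : pdiag) : Prop :=
  if o then forall x y, x.2 < k <= y.2 -> same_block p x y = false
  else [/\ 0 < k, same_block p (false, k.-1) (false, k)
         & forall x y, x.2 < k <= y.2 -> same_block p x y ->
             same_block p x (false, k)].

Lemma same_block_ptens_low p q x y : x.2 < pdorder p ->
  same_block (ptens p q) x y = same_block p x y.
Proof. by move=> hx; rewrite same_block_ptens [_ <= x.2]leqNgt hx orbF. Qed.

Lemma same_block_ptens_high p q x y : pdorder p <= x.2 ->
  same_block (ptens p q) x y = (pdorder p <= y.2) &&
    same_block q (unshift (pdorder p) x) (unshift (pdorder p) y).
Proof.
move=> hx; rewrite same_block_ptens hx /=.
by case: (boolP (same_block p x y)) => // /same_block_lt[]; lia.
Qed.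

(** Merging creates no new link inside [a]: since [(k+1)'] is not a label of [a], two labels of [a]
    in the merged block were both already in the block of [k']. *)
Lemma slice_op_low o a b : o || (0 < pdorder a) && (0 < pdorder b) ->
  slice (op o a b) 0 (pdorder a) = a.
Proof.
move=> hab; apply: pdiag_eq => // x y; rewrite same_block_slice; last first.
  by rewrite pdorder_op leq_addr.
rewrite /shift !add0n -!surjective_pairing.
have [hx|hx] := ltnP x.2 (pdorder a); last first.
  by case: (boolP (same_block a x y)) => // /same_block_lt[]; lia.
have [hy|hy] := ltnP y.2 (pdorder a); last first.
  by case: (boolP (same_block a x y)) => // /same_block_lt[]; lia.
case: o hab => [_|/andP[a0 b0]] /=; first by rewrite same_block_ptens_low.
rewrite same_block_pbullet // !same_block_ptens_low //.
have nofirst z : same_block a z (false, pdorder a) = false.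
  by apply/negbTE/negP => /same_block_lt[] _; rewrite ltnn.
rewrite !nofirst !orbF; case: (boolP (same_block a x y)) => //= hxy.
apply/negbTE/negP => /andP[xl yl]; case/negP: hxy.
by apply: same_block_trans xl _; rewrite same_block_sym.
Qed.

Lemma slice_op_high o a b : o || (0 < pdorder a) && (0 < pdorder b) ->
  slice (op o a b) (pdorder a) (pdorder b) = b.
Proof.
move=> hab; apply: pdiag_eq => // x y; rewrite same_block_slice; last first.
  by rewrite pdorder_op.
have [hx|hx] := ltnP x.2 (pdorder b); last first.
  by case: (boolP (same_block b x y)) => // /same_block_lt[]; lia.
have [hy|hy] := ltnP y.2 (pdorder b); last first.
  by case: (boolP (same_block b x y)) => // /same_block_lt[]; lia.
have high z : pdorder a <= (shift (pdorder a) z).2 by rewrite leq_addr.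
case: o hab => [_|/andP[a0 b0]] /=.
  by rewrite same_block_ptens_high // !shiftK high.
rewrite same_block_pbullet // !same_block_ptens_high // !shiftK !high /= leqnn.
have -> : (pdorder a <= (pdorder a).-1) = false by lia.
case: (boolP (same_block b x y)) => //= hxy.
apply/negbTE/negP => /andP[xl yl]; case/negP: hxy.
by apply: same_block_trans xl _; rewrite same_block_sym.
Qed.

Lemma cut_op o a b : o || (0 < pdorder a) && (0 < pdorder b) ->
  cut o (pdorder a) (op o a b).
Proof.
case: o => [_|/andP[a0 b0]] /=.
  move=> x y /andP[hx hy]; rewrite same_block_ptens_low //.
  by apply/negbTE/negP => /same_block_lt[]; lia.
have nearlast : same_block (ptens a b) (false, (pdorder a).-1)
    (false, (pdorder a).-1).
  by apply: same_block_refl; rewrite pdorder_ptens /=; lia.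
have nearfirst : same_block (ptens a b) (false, pdorder a) (false, pdorder a).
  by apply: same_block_refl; rewrite pdorder_ptens /=; lia.
split=> //; first by rewrite same_block_pbullet // nearlast nearfirst !orbT.
move=> x y /andP[hx hy]; rewrite !same_block_pbullet // nearfirst orbT.
rewrite (_ : same_block (ptens a b) x y = false); last first.
  rewrite same_block_ptens_low //.
  by apply/negbTE/negP => /same_block_lt[]; lia.
by case/andP=> ->; rewrite orbT.
Qed.

(** Converse of [cut_op]. The two relations are compared according to the sides of the cut on which
    [x] and [y] lie. *)
Lemma op_slices o k p : cut o k p -> k <= pdorder p ->
  p = op o (slice p 0 k) (slice p k (pdorder p - k)).
Proof.
move=> hc hk; apply: pdiag_eq => [|x y].
  by rewrite pdorder_op /pdorder /= subnKC.
have low z t : z.2 < k -> t.2 < k ->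
    same_block (slice p 0 k) z t = same_block p z t.
  by case: z t => bz iz [bt it] zk tk; rewrite same_block_slice ?zk ?tk.
have high z t : k <= z.2 -> k <= t.2 ->
    same_block (slice p k (pdorder p - k)) (unshift k z) (unshift k t)
    = same_block p z t.
  move=> zk tk; rewrite same_block_slice ?subnKC // !unshiftK //=.
  apply/and3P/idP => [[]//|hzt]; split=> //; case/same_block_lt: hzt; lia.
have tLL z t : z.2 < k -> t.2 < k ->
    same_block (ptens (slice p 0 k) (slice p k (pdorder p - k))) z t
    = same_block p z t.
  by move=> zk tk; rewrite same_block_ptens_low ?low.
have tLH z t : z.2 < k -> k <= t.2 ->
    same_block (ptens (slice p 0 k) (slice p k (pdorder p - k))) z t = false.
  move=> zk tk; rewrite same_block_ptens_low //.
  by apply/negbTE/negP => /same_block_lt[_]; rewrite ltnNge tk.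
have tHH z t : k <= z.2 -> k <= t.2 ->
    same_block (ptens (slice p 0 k) (slice p k (pdorder p - k))) z t
    = same_block p z t.
  by move=> zk tk; rewrite same_block_ptens_high // tk high.
rewrite /op; case: o hc => [hc|[k0 lastfirst cross]].
  have [xk|xk] := ltnP x.2 k; have [yk|yk] := ltnP y.2 k.
  - by rewrite tLL.
  - by rewrite tLH // hc // xk.
  - by rewrite [RHS]same_block_sym tLH // same_block_sym hc // yk.
  - by rewrite tHH.
have [_ kp] := same_block_lt lastfirst.
rewrite same_block_pbullet // ?subn_gt0 //.
rewrite [pdorder (slice p 0 k)]/=.
set T := ptens _ _ in tLL tLH tHH *; clearbody T.
have k1 : (false, k.-1).2 < k by rewrite /= prednK.
(* The merged block, computed from the slices, is the block of [(k+1)'] in [p], because [p] joins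
   [k'] to [(k+1)']. *)
have nearE z : same_block T z (false, k.-1) || same_block T z (false, k)
    = same_block p z (false, k).
  have [zk|zk] := ltnP z.2 k; last by rewrite same_block_sym tLH // tHH.
  rewrite tLL // tLH // orbF.
  apply/idP/idP => h; first exact: same_block_trans lastfirst.
  by apply: same_block_trans h _; rewrite same_block_sym.
rewrite (nearE x) (nearE y).
have trans z t : same_block p z (false, k) && same_block p t (false, k) ->
    same_block p z t.
  by case/andP=> hz ht; apply: same_block_trans hz _; rewrite same_block_sym.
(* On one side of the cut, the links added by merging hold in [p] already, by transitivity; across
   the cut, [crossE] shows that they are the only links. *)
have orE (b c : bool) : (c -> b) -> b = b || c by case: b;
  case: c => // /(_ _)->.
have crossE z t : z.2 < k -> k <= t.2 -> same_block p z t =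
    same_block p z (false, k) && same_block p t (false, k).
  move=> zk tk; apply/idP/idP => [hzt|/trans//].
  have hz : same_block p z (false, k) by apply: cross hzt; rewrite zk.
  by rewrite hz /=; apply: same_block_trans hz; rewrite same_block_sym.
have [xk|xk] := ltnP x.2 k; have [yk|yk] := ltnP y.2 k.
- by rewrite tLL //; apply/orE/trans.
- by rewrite tLH // crossE.
- by rewrite [in RHS]same_block_sym tLH // same_block_sym crossE // andbC.
- by rewrite tHH //; apply/orE/trans.
Qed.

Lemma cut_slice_low o j k p : cut o k p -> k < j -> j <= pdorder p ->
  cut o k (slice p 0 j).
Proof.
move=> hc kj jp; have low x y :
    same_block (slice p 0 j) x y = [&& x.2 < j, y.2 < j & same_block p x y].
  by case: x y => bx x [b y]; rewrite same_block_slice.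
case: o hc => [hc|[k0 h hc]]; rewrite /cut.
  by move=> x y hxy; rewrite low hc // !andbF.
split=> //; first by rewrite low h kj /= (leq_ltn_trans (leq_pred k)).
move=> x y hxy; rewrite !low kj /= => /and3P[-> _ h'] /=.
exact: hc h'.
Qed.

Lemma cut_slice_high o j k p : cut o j p -> k < j -> j <= pdorder p ->
  cut o (j - k) (slice p k (pdorder p - k)).
Proof.
move=> hc kj jp.
have high x y : same_block (slice p k (pdorder p - k)) x y =
    same_block p (shift k x) (shift k y).
  rewrite same_block_slice ?subnKC ?(leq_trans (ltnW kj)) //.
  by apply/and3P/idP => [[]//|h]; case/same_block_lt: (h) => /=; split=> //;
    lia.
case: o hc => [hc|[j0 h hc]]; rewrite /cut.
  by move=> x y hxy; rewrite high hc //=; lia.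
split=> [||x y hxy]; first by rewrite subn_gt0.
  rewrite high /shift /= subnKC ?(ltnW kj) //.
  by rewrite (_ : k + (j - k).-1 = j.-1) //; lia.
rewrite !high => h'.
have -> : shift k (false, j - k) = (false, j) by rewrite /shift /= subnKC // ltnW.
by apply: hc h' => /=; lia.
Qed.

(** Lifting a cut from a prefix uses that the prefix ends at a cut: no block can cross [k] and reach
    past [j] without also being seen in the prefix, at or after [k]. *)
Lemma cut_of_slice o o' j k p : cut o' j p -> cut o k (slice p 0 j) ->
  k < j -> j <= pdorder p -> cut o k p.
Proof.
move=> hj hk kj jp; have low x y :
    same_block (slice p 0 j) x y = [&& x.2 < j, y.2 < j & same_block p x y].
  by case: x y => bx x [b y]; rewrite same_block_slice.
have cross x y : x.2 < k <= y.2 -> same_block p x y ->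
    exists2 z, k <= z.2 & same_block (slice p 0 j) x z.
  case/andP=> xk ky hxy; have xj : x.2 < j by apply: ltn_trans kj.
  have [yj|jy] := ltnP y.2 j; first by exists y; rewrite // low xj yj.
  case: o' hj => [hj|[j0 lastfirst hj]]; first by rewrite hj ?xj in hxy.
  (* A block that crosses the bullet cut at [j] contains the label [j'], whose index [j.-1] is still
     at least [k]. *)
  exists (false, j.-1); first by rewrite /= -ltnS prednK.
  rewrite low xj /= prednK // leqnn /=.
  apply: same_block_trans (hj _ _ _ hxy) _; first by rewrite xj.
  by rewrite same_block_sym.
case: o hk => [hk|[k0 h hk]]; rewrite /cut.
  move=> x y hxy; apply/negbTE/negP => /(cross _ _ hxy)[z kz].
  by rewrite hk //; case/andP: hxy => ->.
split=> // [|x y hxy /(cross _ _ hxy)[z kz hz]].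
  by move: h; rewrite low => /and3P[].
have /hk/(_ hz) : x.2 < k <= z.2 by rewrite kz; case/andP: hxy => ->.
by rewrite low => /and3P[].
Qed.

(** The link between [k'] and [(k+1)'] is forbidden by one kind of cut and required by the other. *)
Lemma cut_inj o o' k p : cut o k p -> cut o' k p -> o = o'.
Proof.
have aux : cut true k p -> cut false k p -> False.
  by move=> hc [k0]; rewrite hc //= prednK ?leqnn.
by case: o o' => [] [] // h h'; case: aux.
Qed.

(** * Cancellation and associativity *)

Lemma op_inj o o' a b c d :
  o || (0 < pdorder a) && (0 < pdorder b) ->
  o' || (0 < pdorder c) && (0 < pdorder d) ->
  op o a b = op o' c d -> pdorder a = pdorder c -> [/\ o = o', a = c & b = d].
Proof.
move=> hab hcd e eac; split.
- by apply: (@cut_inj _ _ (pdorder a) (op o a b));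
  rewrite ?[in X in cut o' X]eac
    ?[in X in cut o' _ X]e; apply: cut_op.
- by rewrite -(slice_op_low hab) e eac slice_op_low.
- have ebd : pdorder b = pdorder d.
    apply: (@addnI (pdorder a)).
    by rewrite {2}eac -(pdorder_op o) -(pdorder_op o') e.
  by rewrite -(slice_op_high hab) e eac ebd slice_op_high.
Qed.

(** The cut after [a] lies strictly inside [c], so restricting it to the prefix [c] splits [c]. This
    is the source of uniqueness: an irreducible first factor admits no shorter rival. *)
Lemma op_prefix o o' a b c d :
  o || (0 < pdorder a) && (0 < pdorder b) ->
  o' || (0 < pdorder c) && (0 < pdorder d) ->
  op o a b = op o' c d -> pdorder a < pdorder c ->
  exists2 e, 0 < pdorder e & c = op o a e.
Proof.
move=> hab hcd e lac; exists (slice c (pdorder a) (pdorder c - pdorder a)).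
  by rewrite /pdorder /= subn_gt0.
have hc := slice_op_low hcd.
have le_c : pdorder c <= pdorder (op o' c d) by rewrite pdorder_op leq_addr.
have cut_c : cut o (pdorder a) c.
  by rewrite -hc; apply: cut_slice_low => //; rewrite -e; apply: cut_op.
rewrite {1}(op_slices cut_c (ltnW lac)); congr (op o _ _).
by rewrite -{1}hc slice_slice ?add0n ?(ltnW lac) // -e slice_op_low.
Qed.

(** The left-nested product has a cut after [b], and the cut after [a] lifts from its prefix;
    splitting at both recovers the three factors. Nonemptiness matters: with [b] empty, a tensor
    product followed by a bullet product would be the bullet product of [a] and [c] in one
    bracketing and their tensor product in the other. *)
Lemma op_assoc o o' a b c :
  0 < pdorder a -> 0 < pdorder b -> 0 < pdorder c ->
  op o' (op o a b) c = op o a (op o' b c).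
Proof.
move=> a0 b0 c0; set p := op o' _ c.
have hab : o || (0 < pdorder a) && (0 < pdorder b) by rewrite a0 b0 orbT.
have hp : o' || (0 < pdorder (op o a b)) && (0 < pdorder c).
  by rewrite c0 pdorder_op addn_gt0 a0 orbT.
have ep : pdorder p = pdorder a + pdorder b + pdorder c by rewrite !pdorder_op.
have lowp : slice p 0 (pdorder a + pdorder b) = op o a b.
  by rewrite -(pdorder_op o) slice_op_low.
have cutj : cut o' (pdorder a + pdorder b) p.
  by rewrite -(pdorder_op o); apply: cut_op.
have cutk : cut o (pdorder a) p.
  apply: (cut_of_slice cutj); last by lia.
    by rewrite lowp; apply: cut_op.
  by lia.
rewrite {1}(op_slices cutk); last by lia.
congr (op o _ _).
  rewrite -(slice_op_low hab) -lowp slice_slice //; lia.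
set r := slice p _ _; have er : pdorder r = pdorder b + pdorder c.
  by rewrite [LHS](_ : _ = pdorder p - pdorder a) // ep -addnA addKn.
have cutr : cut o' (pdorder b) r.
  by rewrite -(addKn (pdorder a) (pdorder b)); apply: cut_slice_high => //; lia.
rewrite {1}(op_slices cutr); last by lia.
rewrite er addKn /r !slice_slice; try lia.
rewrite addn0; congr (op o' _ _).
  rewrite -{2}(slice_op_high hab) -lowp slice_slice //; lia.
by rewrite -{2}(slice_op_high hp) pdorder_op.
Qed.

Lemma pdorder0 p : pdorder p = 0 -> p = empty_pd.
Proof.
move=> p0; apply: pdiag_eq => // x y.
by apply/idP/idP => /same_block_lt[]; rewrite ?p0.
Qed.

Lemma ptens0p p : ptens empty_pd p = p.
Proof.
rewrite -[RHS](@slice_op_high true empty_pd p) //.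
by rewrite -[LHS]slice_full pdorder_ptens.
Qed.

Lemma ptensp0 p : ptens p empty_pd = p.
Proof.
rewrite -[RHS](@slice_op_low true p empty_pd) //.
by rewrite -[LHS]slice_full pdorder_ptens addn0.
Qed.

Lemma ptensA p q r : ptens (ptens p q) r = ptens p (ptens q r).
Proof.
case: (posnP (pdorder p)) => [/pdorder0->|p0]; first by rewrite !ptens0p.
case: (posnP (pdorder q)) => [/pdorder0->|q0]; first by rewrite ptensp0 ptens0p.
case: (posnP (pdorder r)) => [/pdorder0->|r0]; first by rewrite !ptensp0.
exact: (op_assoc true true).
Qed.

Lemma ptens_inj a b c d : ptens a b = ptens c d -> pdorder a = pdorder c ->
  a = c /\ b = d.
Proof. by move=> e /(@op_inj true true a b c d isT isT e)[]. Qed.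

(** * Unique factorization into irreducibles for both products *)

Lemma nediag_gt0 (x : nediag) : 0 < pdorder (val x).
Proof. by case: x. Qed.

Lemma neop_subproof o (x y : nediag) : 0 < pdorder (op o (val x) (val y)).
Proof. by rewrite pdorder_op addn_gt0 (nediag_gt0 x). Qed.

Definition neop o (x y : nediag) : nediag := Sub (op o (val x) (val y))
  (neop_subproof o x y).

Lemma val_neop o x y : val (neop o x y) = op o (val x) (val y).
Proof. by []. Qed.

Lemma neop_assoc o o' x y z : neop o' (neop o x y) z = neop o x (neop o' y z).
Proof. by apply: val_inj;
  rewrite /= op_assoc ?(nediag_gt0 x) ?(nediag_gt0 y) ?(nediag_gt0 z). Qed.

Lemma neop_nonempty o (x y : nediag) :
  o || (0 < pdorder (val x)) && (0 < pdorder (val y)).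
Proof. by rewrite (nediag_gt0 x) (nediag_gt0 y) orbT. Qed.

Definition irreducible (x : nediag) : Prop :=
  tens_irr (val x) /\ bullet_irr (val x).

Lemma neop_reducible o x y : ~ irreducible (neop o x y).
Proof. by case: o => -[ht hb]; [apply: (ht x y)|apply: (hb x y)]. Qed.

Lemma irreducibleP x :
  irreducible x \/ exists o y z, x = neop o y z.
Proof.
have [[y [z e]]|nt] := EM (exists y z : nediag, val x = ptens (val y) (val z)).
  by right; exists true, y, z; apply: val_inj.
have [[y [z e]]|nb] := EM (exists y z : nediag, val x = pbullet (val y) (val z)).
  by right; exists false, y, z; apply: val_inj.
by left; split=> y z e; [apply: nt|apply: nb]; exists y, z.
Qed.

Lemma neop_irreducible_inj o o' x y x' y' : irreducible x -> irreducible x' ->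
  neop o x y = neop o' x' y' -> [/\ o = o', x = x' & y = y'].
Proof.
move=> ix ix' /(congr1 (fun z : nediag => val z)) e.
rewrite !val_neop in e.
(* A first factor [a] shorter than [a'] would split [a'] by [op_prefix], against irreducibility.
   Used in both directions, this equates the orders. *)
have nlt (a b a' b' : nediag) p p' : irreducible a' ->
    op p (val a) (val b) = op p' (val a') (val b') ->
    pdorder (val a') <= pdorder (val a).
  move=> ia' eab; rewrite leqNgt; apply/negP.
  case/(op_prefix (neop_nonempty _ _ _) (neop_nonempty _ _ _) eab) => c c0 ea'.
  have ec : a' = neop p a (Sub c c0) by apply: val_inj.
  by rewrite ec in ia'; apply: neop_reducible ia'.
have exx : pdorder (val x) = pdorder (val x').
  by apply/eqP; rewrite eqn_leq (nlt _ _ _ _ _ _ ix (esym e)) (nlt _ _ _ _ _ _ ix' e).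
have [-> /val_inj-> /val_inj->] :=
  op_inj (neop_nonempty _ _ _) (neop_nonempty _ _ _) e exx.
by [].
Qed.

(** Right-nested counterpart of the left fold [mixed_prod], equal to it by associativity. It exposes
    the first factor, which is what the inductions peel off. *)
Fixpoint mixed (x : nediag) (s : seq nediag) (o : seq bool) : nediag :=
  match s, o with
  | y :: s', c :: o' => neop c x (mixed y s' o')
  | _, _ => x
  end.

Lemma mixed_neop c x y s o : mixed (neop c x y) s o = neop c x (mixed y s o).
Proof. by case: s o => [|z s] [|d o] //=; rewrite neop_assoc. Qed.

Lemma mixed_prodE x s o : size s = size o -> mixed_prod x s o = val (mixed x s o).
Proof.
elim: s o x => [|y s IH] [|c o] // x [/IH e].
by rewrite [mixed _ _ _]/= -mixed_neop -e; case: c.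
Qed.

Lemma mixed_cat x s o c y t o' : size s = size o ->
  mixed x (s ++ y :: t) (o ++ c :: o') = neop c (mixed x s o) (mixed y t o').
Proof.
elim: s o x => [|z s IH] [|d o] // x [/IH e] /=.
by rewrite e neop_assoc.
Qed.

(** First factors and first operators agree by [neop_irreducible_inj], and induction does the rest.
    If one sequence ended earlier, an irreducible would equal a product. *)
Lemma mixed_inj x s o y t o' : size s = size o -> size t = size o' ->
  (forall z, z \in x :: s -> irreducible z) ->
  (forall z, z \in y :: t -> irreducible z) ->
  mixed x s o = mixed y t o' -> [/\ x = y, s = t & o = o'].
Proof.
elim: s o x y t o' => [|z s IH] [|c o] // x y [|w t] [|d o'] //=.
- move=> _ _ ix _ e; have := ix x; rewrite e inE eqxx => /(_ isT).
  by move/neop_reducible.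
- move=> _ _ _ iy e; have := iy y; rewrite -e inE eqxx => /(_ isT).
  by move/neop_reducible.
move=> [es] [et] ix iy e.
have [||-> -> e'] := neop_irreducible_inj _ _ e.
- by apply: ix; rewrite mem_head.
- by apply: iy; rewrite mem_head.
have [||-> -> ->//] := IH _ _ _ _ _ es et _ _ e' => v hv.
  by apply: ix; rewrite inE hv orbT.
by apply: iy; rewrite inE hv orbT.
Qed.

(** Strong induction on the order: a reducible diagram is a product of two smaller ones, whose
    factorizations are concatenated around the operator. *)
Lemma mixed_exists x : exists y s o, [/\ size s = size o,
  forall z, z \in y :: s -> irreducible z & x = mixed y s o].
Proof.
have [n le_n] := ubnP (pdorder (val x)).
elim: n x le_n => // n IH x /ltnSE le_n.
have [ix|[c [y [z e]]]] := irreducibleP x.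
  by exists x, [::], [::]; split=> // z; rewrite inE => /eqP->.
rewrite e val_neop pdorder_op in le_n *.
have y0 : 0 < pdorder (val y) := nediag_gt0 y.
have z0 : 0 < pdorder (val z) := nediag_gt0 z.
have [|y1 [s1 [o1 [e1 i1 ->]]]] := IH y; first by lia.
have [|z1 [s2 [o2 [e2 i2 ->]]]] := IH z; first by lia.
exists y1, (s1 ++ z1 :: s2), (o1 ++ c :: o2); split.
- by rewrite !size_cat /= e1 e2.
- by move=> w; rewrite -cat_cons mem_cat => /orP[/i1|/i2].
- by rewrite mixed_cat.
Qed.

(** * Refinement as a partial order compatible with the tensor product *)

Lemma refinesP p q : refines p q <-> (p = empty_pd /\ q = empty_pd) \/
  exists x s o o', [/\ size s = size o, size s = size o',
    forall z, z \in x :: s -> irreducible z,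
    p = val (mixed x s o) /\ q = val (mixed x s o')
    & forall i, tens_positions o' i -> tens_positions o i].
Proof.
split=> [[|[x [s [o [o' [[e i ->] [e' _ ->] h]]]]]]|[|[x [s [o [o' [e e' i [-> ->] h]]]]]]];
  try by left.
  by right; exists x, s, o, o'; rewrite !mixed_prodE.
right; exists x, s, o, o'; split=> //; split=> //; by rewrite mixed_prodE.
Qed.

Lemma nonempty_pdiag p : p = empty_pd \/ exists x : nediag, p = val x.
Proof.
case: (posnP (pdorder p)) => [/pdorder0|p0]; first by left.
by right; exists (Sub p p0).
Qed.

Lemma val_nonempty (x : nediag) : val x <> empty_pd.
Proof. by move=> e; have := nediag_gt0 x; rewrite e. Qed.

Lemma pdle_refl p : pdle p p.
Proof.
apply/asboolP/refinesP; have [->|[x ->]] := nonempty_pdiag p; first by left.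
have [y [s [o [e i ->]]]] := mixed_exists x.
by right; exists y, s, o, o.
Qed.

(** Uniqueness identifies the two factorizations of the middle diagram, so the inclusions of tensor
    positions compose. *)
Lemma pdle_trans p q r : pdle p q -> pdle q r -> pdle p r.
Proof.
move=> /asboolP/refinesP[[-> ->] //|[x [s [o [o' [e e' i [-> ->] h]]]]]].
move=> /asboolP/refinesP[[/val_nonempty //]|].
case=> [y [t [o1 [o1' [e1 e1' i1 [/val_inj eq1 ->] h1]]]]].
have [ey et eo] := mixed_inj e' e1 i i1 eq1; subst y t o1.
apply/asboolP/refinesP; right; exists x, s, o, o1'; split=> // j hj.
exact/h/h1.
Qed.

Lemma pdle_anti p q : pdle p q -> pdle q p -> p = q.
Proof.
move=> /asboolP/refinesP[[-> ->] //|[x [s [o [o' [e e' i [-> ->] h]]]]]].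
move=> /asboolP/refinesP[[/val_nonempty //]|].
case=> [y [t [o1 [o1' [e1 e1' i1 [/val_inj eq1 /val_inj eq2] h1]]]]].
have [ey et eo] := mixed_inj e' e1 i i1 eq1; subst y t o1.
have [_ _ eo] := mixed_inj e e1' i i1 eq2; subst o1'.
congr (val (mixed x s _)); apply: (@eq_from_nth _ false); rewrite -?e -?e' //.
by move=> j _; apply/idP/idP; [apply: h1|apply: h].
Qed.

Lemma pdle_ptens p q p' q' : pdle p p' -> pdle q q' ->
  pdle (ptens p q) (ptens p' q').
Proof.
move=> /asboolP/refinesP[[-> ->]|[x [s [o1 [o2 [e1 e2 i [-> ->] h]]]]]].
  by rewrite !ptens0p.
move=> /asboolP/refinesP[[-> ->]|[y [t [o3 [o4 [e3 e4 j [-> ->] h']]]]]].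
  rewrite !ptensp0; apply/asboolP/refinesP; right.
  by exists x, s, o1, o2.
apply/asboolP/refinesP; right.
exists x, (s ++ y :: t), (o1 ++ true :: o3), (o2 ++ true :: o4).
split.
- by rewrite !size_cat /= e1 e3.
- by rewrite !size_cat /= e2 e4.
- by move=> w; rewrite -cat_cons mem_cat => /orP[/i|/j].
- by rewrite !mixed_cat.
- move=> k; rewrite /tens_positions !nth_cat -e1 -e2.
  by case: ltnP => // _; [apply: h|case: (k - size s) => //= l; apply: h'].
Qed.

(** By uniqueness, [p] has the irreducible factors of [q] followed by those of [r]. The upper
    diagram has a tensor at the junction, so [p] has one there too and splits. Empty [q] or [r] have
    no irreducible factors and are treated first. *)
Lemma pdle_ptens_split p q r : pdle p (ptens q r) ->
  exists p1 p2, [/\ p = ptens p1 p2, pdle p1 q & pdle p2 r].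
Proof.
have [->|[y ->]] := nonempty_pdiag q.
  by rewrite ptens0p => h; exists empty_pd, p; rewrite ptens0p pdle_refl.
have [->|[z ->]] := nonempty_pdiag r.
  by rewrite ptensp0 => h; exists p, empty_pd; rewrite ptensp0 pdle_refl.
have [y1 [s1 [o1 [e1 i1 ey]]]] := mixed_exists y.
have [z1 [s2 [o2 [e2 i2 ez]]]] := mixed_exists z.
move=> /asboolP/refinesP[[_ /(@val_nonempty (neop true y z)) //]|].
case=> x [s [o [o' [e e' i [-> eyz] h]]]].
have eyz' : mixed y1 (s1 ++ z1 :: s2) (o1 ++ true :: o2) = mixed x s o'.
  by apply: val_inj; rewrite -eyz mixed_cat // -ey -ez.
have i12 w : w \in y1 :: s1 ++ z1 :: s2 -> irreducible w.
  by rewrite -cat_cons mem_cat => /orP[/i1|/i2].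
have e12 : size (s1 ++ z1 :: s2) = size (o1 ++ true :: o2).
  by rewrite !size_cat /= e1 e2.
have [ex es eo'] := mixed_inj e12 e' i12 i eyz'; subst x s o'.
have lt1 : size o1 < size o by rewrite -e size_cat /= e1; lia.
(* Index [size o1] is the junction, where [h] forces the operator of [p] to be a tensor. *)
have eo : o = take (size o1) o ++ true :: drop (size o1).+1 o.
  rewrite -{1}(cat_take_drop (size o1) o) (drop_nth false) //.
  congr (_ ++ _ :: _); apply/esym/esym/h.
  by rewrite /tens_positions nth_cat ltnn subnn.
set l := take _ _ in eo; set d := drop _ _ in eo.
have sl : size l = size o1 by rewrite size_take lt1.
have sd : size d = size o2.
  by rewrite size_drop -e size_cat /= e1 e2 addnS subSS addKn.
clearbody l d; subst o; exists (val (mixed y1 s1 l)), (val (mixed z1 s2 d)).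
split; first by rewrite mixed_cat // sl.
- apply/asboolP/refinesP; right; exists y1, s1, l, o1.
  rewrite ey sl; split=> // j hj; have := h j;
    rewrite /tens_positions !nth_cat sl.
  case: ltnP => [_|le_j]; first exact.
  by move: hj; rewrite /tens_positions nth_default.
- apply/asboolP/refinesP; right; exists z1, s2, d, o2.
  (* The successor skips the junction operator. *)
  rewrite ez sd; split=> // j hj; have := h (size o1 + j.+1).
  rewrite /tens_positions !nth_cat sl ltnNge leq_addr /= addKn /=; exact.
Qed.

(** * Tensor factorizations and relative factors *)

Lemma tens_seq_cat s t : tens_seq (s ++ t) = ptens (tens_seq s) (tens_seq t).
Proof. by elim: s => [|x s IH] /=; rewrite ?ptens0p // IH ptensA. Qed.

Lemma tens_factorization_exists p : exists s, is_tens_factorization p s.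
Proof.
have [n le_n] := ubnP (pdorder p).
elim: n p le_n => // n IH p /ltnSE le_n.
have [->|[x ex]] := nonempty_pdiag p; first by exists [::].
have [[y [z e]]|nt] := EM (exists y z : nediag, p = ptens (val y) (val z)).
  have y0 : 0 < pdorder (val y) := nediag_gt0 y.
  have z0 : 0 < pdorder (val z) := nediag_gt0 z.
  rewrite e pdorder_ptens in le_n.
  have [|s [is1 es]] := IH (val y); first by lia.
  have [|t [it et]] := IH (val z); first by lia.
  exists (s ++ t); split; last by rewrite tens_seq_cat -es -et.
  by move=> a; rewrite mem_cat => /orP[/is1|/it].
exists [:: x]; split; last by rewrite /= ptensp0.
by move=> a; rewrite inE => /eqP-> y z e; apply: nt; exists y, z; rewrite ex.
Qed.

Lemma tens_seq_gt0 s : s != [::] -> 0 < pdorder (tens_seq s).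
Proof. by case: s => // x s _; rewrite pdorder_ptens addn_gt0 (nediag_gt0 x).
  Qed.

(** As for mixed factorizations, [op_prefix] forces the first irreducible factors to have equal
    orders, after which they cancel. *)
Lemma tens_factorization_uniq p s t :
  is_tens_factorization p s -> is_tens_factorization p t -> s = t.
Proof.
move=> [is1 ->] [it e]; elim: s t is1 it e => [|x s IH] [|y t] // is1 it /=.
- by move=> e; have := @tens_seq_gt0 (y :: t) isT; rewrite -[tens_seq _]e.
- by move=> e; have := @tens_seq_gt0 (x :: s) isT; rewrite [tens_seq _]e.
move=> e; have nlt (a b : nediag) u v : tens_irr (val b) ->
    ptens (val a) u = ptens (val b) v -> pdorder (val b) <= pdorder (val a).
  move=> ib eab; rewrite leqNgt; apply/negP.
  case/(@op_prefix true true _ _ _ _ isT isT eab) => c c0 eb.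
  exact: (ib a (Sub c c0)).
have ix : tens_irr (val x) by apply: is1; rewrite mem_head.
have iy : tens_irr (val y) by apply: it; rewrite mem_head.
have exy : pdorder (val x) = pdorder (val y).
  by apply/eqP; rewrite eqn_leq (nlt _ _ _ _ ix (esym e)) (nlt _ _ _ _ iy e).
have [exy' /IH <-] := ptens_inj e exy => [|a ha|a ha].
- by rewrite (val_inj (exy' : val x = val y)).
- by apply: is1; rewrite inE ha orbT.
- by apply: it; rewrite inE ha orbT.
Qed.

(** The factors of [r] are peeled off one at a time with [pdle_ptens_split]. Each piece of [p] is
    nonempty because refinement preserves the order. *)
Lemma relative_factorization_exists p r : pdle p r ->
  exists s, is_relative_factorization p r s.
Proof.
have [rs [irs ->]] := tens_factorization_exists r.
elim: rs p irs => [|x rs IH] p irs.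
  move/pdorder_pdle/pdorder0->; exists [::]; split=> //.
  by exists [::].
case/pdle_ptens_split=> p1 [p2 [-> h1 /IH h2]].
have [|s [es [rs' [frs' hs]]]] := h2.
  by move=> a ha; apply: irs; rewrite inE ha orbT.
have p1_gt0 : 0 < pdorder p1 by rewrite (pdorder_pdle h1) (nediag_gt0 x).
have ers : rs' = rs.
  apply: tens_factorization_uniq frs' _; split=> // a ha.
  by apply: irs; rewrite inE ha orbT.
exists (Sub p1 p1_gt0 :: s); split; first by rewrite /= -es.
by exists (x :: rs); split; [split|rewrite /= h1 -ers].
Qed.

(** The orders of the pieces are prescribed by the factors of [r], and a tensor product with
    prescribed orders determines its factors. *)
Lemma relative_factorization_uniq p r s t :
  is_relative_factorization p r s -> is_relative_factorization p r t -> s = t.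
Proof.
move=> [-> [rs [frs hs]]] [e [rs' [frs' ht]]].
have ers := tens_factorization_uniq frs' frs; subst rs'; clear frs frs'.
elim: rs s t e hs ht => [|x rs IH] [|a s] [|b t] //= e.
case/andP=> /pdorder_pdle ea hs /andP[/pdorder_pdle eb ht].
have [|eab /IH<- //] := ptens_inj e; first by rewrite ea eb.
by rewrite (val_inj (eab : val a = val b)).
Qed.

Lemma relative_factorsP p r : pdle p r ->
  is_relative_factorization p r (relative_factors p r).
Proof.
by move=> /relative_factorization_exists[s hs]; apply: classical_sets.xgetPex;
  exists s.
Qed.

(** The concatenation is a relative factorization, hence the one by uniqueness. This makes the
    coefficients f(p, r) multiplicative. *)
Lemma relative_factors_ptens p q p' q' : pdle p p' -> pdle q q' ->
  relative_factors (ptens p q) (ptens p' q') =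
  relative_factors p p' ++ relative_factors q q'.
Proof.
move=> hp hq; have := relative_factorsP (pdle_ptens hp hq).
move/relative_factorization_uniq; apply.
have [ep [rs [[irs ers] hs]]] := relative_factorsP hp.
have [eq [rt [[irt ert] ht]]] := relative_factorsP hq.
split; first by rewrite tens_seq_cat -ep -eq.
exists (rs ++ rt); split; last first.
  by elim: (relative_factors p p') (rs) hs => [|a s IH] [|b u] //= /andP[-> /IH].
split; last by rewrite tens_seq_cat -ers -ert.
by move=> a; rewrite mem_cat => /orP[/irs|/irt].
Qed.

Lemma relative_factors_refl p :
  is_tens_factorization p (relative_factors p p).
Proof.
have [s hs] := tens_factorization_exists p.
rewrite (@relative_factorization_uniq p p (relative_factors p p) s) //.
  exact/relative_factorsP/pdle_refl.
split; first by case: hs.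
by exists s; split=> //; elim: (s) => //= a t ->; rewrite pdle_refl.
Qed.

(** * Linear extension from a basis, and bilinearity of the tensor product *)

Local Open Scope ring_scope.

Section LinearExtension.
Variables (K : fieldType) (S : choiceType) (V : lmodType K).
Implicit Types (G : S -> V) (u : {malg K[S]}).

(** Both [coproduct] and, in each variable, [tensv] have this shape, so their linearity is
    established once here. *)
Definition linear_extension G u : V := \sum_(k <- msupp u) u@_k *: G k.

Lemma linear_extensionEw G u (d : {fset S}) : (msupp u `<=` d)%fset ->
  linear_extension G u = \sum_(k <- d) u@_k *: G k.
Proof.
move=> ud; apply: big_fset_incl => // k _ /mcoeff_outdom->.
by rewrite scale0r.
Qed.

Lemma linear_extensionZ G c u :
  linear_extension G (c *: u) = c *: linear_extension G u.
Proof.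
rewrite (linear_extensionEw _ (msuppZ_le c u)) scaler_sumr.
by apply: eq_bigr => k _; rewrite mcoeffZ scalerA.
Qed.

Lemma linear_extensionD G u v :
  linear_extension G (u + v) = linear_extension G u + linear_extension G v.
Proof.
rewrite (linear_extensionEw _ (msuppD_le u v)).
rewrite (linear_extensionEw _ (fsubsetUl (msupp u) (msupp v))).
rewrite (linear_extensionEw _ (fsubsetUr (msupp u) (msupp v))) -big_split.
by apply: eq_bigr => k _; rewrite mcoeffD scalerDl.
Qed.

Lemma linear_extension0 G : linear_extension G 0 = 0.
Proof. by rewrite /linear_extension msupp0 big_nil. Qed.

Lemma linear_extension_sum I (r : seq I) G (c : I -> K) (u : I -> {malg K[S]}) :
  linear_extension G (\sum_(i <- r) c i *: u i) =
  \sum_(i <- r) c i *: linear_extension G (u i).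
Proof.
elim: r => [|i r IH]; first by rewrite !big_nil linear_extension0.
by rewrite !big_cons linear_extensionD linear_extensionZ IH.
Qed.

End LinearExtension.

Lemma tensvE (K : fieldType) (S T : choiceType)
    (u : {malg K[S]}) (v : {malg K[T]}) :
  tensv u v =
  linear_extension (fun a => linear_extension (fun b => << (a, b) >>) v) u.
Proof.
apply: eq_bigr => a _; rewrite scaler_sumr; apply: eq_bigr => b _.
by rewrite scalerA; apply/malgP => k; rewrite mcoeffZ !mcoeffU mulr_natr.
Qed.

Lemma tensv_sum (K : fieldType) (S T : choiceType) I J (r : seq I) (s : seq J)
    (c : I -> K) (d : J -> K) (u : I -> {malg K[S]}) (v : J -> {malg K[T]}) :
  tensv (\sum_(i <- r) c i *: u i) (\sum_(j <- s) d j *: v j) =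
  \sum_(i <- r) \sum_(j <- s) (c i * d j) *: tensv (u i) (v j).
Proof.
rewrite tensvE linear_extension_sum; apply: eq_bigr => i _.
under [RHS]eq_bigr => j _ do rewrite -scalerA tensvE.
rewrite -scaler_sumr; congr (_ *: _).
rewrite /linear_extension; under [RHS]eq_bigr => j _ do rewrite scaler_sumr.
rewrite exchange_big; apply: eq_bigr => a _ /=.
rewrite -/(linear_extension _ _) linear_extension_sum scaler_sumr.
by apply: eq_bigr => j _; rewrite !scalerA mulrC.
Qed.

(** * Duplicate-free lists indexing the sums *)

Lemma uniq_disjoint_union (S R : eqType) (s : seq S) (T : S -> seq R) :
  uniq s -> (forall i, uniq (T i)) ->
  (forall i j z, i \in s -> j \in s -> z \in T i -> z \in T j -> i = j) ->
  uniq [seq z | i <- s, z <- T i].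
Proof.
move=> us uT disj; apply: allpairs_uniq_dep => // -[i z] [j w].
case/allpairsPdep=> i' [z' [hi hz e]] /allpairsPdep[j' [w' [hj hw e']]] /= ezw.
have [ei ez] : i = i' /\ z = z' by case: e.
have [ej ew] : j = j' /\ w = w' by case: e'.
by subst i' z' j' w' w; rewrite (disj i j z).
Qed.

(** Lists of untyped diagrams replace the dependent index types [diag n], so that sums ranging over
    several orders can be compared by permuting lists. *)
Definition diags n : seq pdiag := [seq mkpd d | d <- enum {: diag n}].

Lemma mem_diags n p : (p \in diags n) = (pdorder p == n).
Proof.
apply/mapP/eqP => [[d _ ->] //|<-]; exists (tagged p);
  first by rewrite mem_enum.
by case: p.
Qed.

Lemma mkpd_inj n : injective (@mkpd n).
Proof. by move=> d d' /eqP; rewrite eq_Tagged => /eqP. Qed.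

Lemma diags_uniq n : uniq (diags n).
Proof. by rewrite map_inj_uniq ?enum_uniq //; apply: mkpd_inj. Qed.

Definition above p : seq pdiag := [seq r <- diags (pdorder p) | pdle p r].

Lemma mem_above p r : (r \in above p) = pdle p r.
Proof.
rewrite mem_filter mem_diags andbC; case: (boolP (pdle p r)) => [h|];
  last first.
  by rewrite andbF.
by rewrite (pdorder_pdle h) eqxx.
Qed.

Lemma above_uniq p : uniq (above p).
Proof. exact/filter_uniq/diags_uniq. Qed.

Lemma sum_aboveE (V : nmodType) p (F : pdiag -> V) :
  sum_above p F = \sum_(r <- above p) F r.
Proof. by rewrite big_filter big_map big_enum_cond. Qed.

Definition splits p : seq (pdiag * pdiag) :=
  [seq x <- [seq y | i <- iota 0 (pdorder p).+1,
                     y <- [seq (a, b) | a <- diags i, b <- diags (pdorder p - i)]]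
  | ptens x.1 x.2 == p].

Lemma mem_splits p x : (x \in splits p) = (ptens x.1 x.2 == p).
Proof.
rewrite mem_filter; case: eqP => [ep|//]; rewrite andTb; apply/allpairsPdep.
exists (pdorder x.1), x; rewrite mem_iota -ep pdorder_ptens ltnS leq_addr.
split=> //; first by rewrite leq_addr.
apply/allpairsPdep; exists x.1, x.2.
by rewrite !mem_diags addKn !eqxx -surjective_pairing.
Qed.

Lemma ptens_splits p x : x \in splits p -> ptens x.1 x.2 = p.
Proof. by rewrite mem_splits => /eqP. Qed.

Lemma splits_uniq p : uniq (splits p).
Proof.
apply/filter_uniq/uniq_disjoint_union => [|i|i j x _ _]; first exact: iota_uniq.
  by apply: allpairs_uniq; rewrite ?diags_uniq // => -[a b] [c d].
case/allpairsPdep=> a [b [ha _ ->]] /allpairsPdep[c [d [hc _ [eac _]]]].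
by move: ha hc; rewrite -eac !mem_diags => /eqP<- /eqP<-.
Qed.

Lemma sum_splitE (V : nmodType) p (F : pdiag -> pdiag -> V) :
  sum_split p F = \sum_(x <- splits p) F x.1 x.2.
Proof.
rewrite big_filter big_mkcond big_allpairs_dep.
rewrite -[iota 0 _]/(index_iota 0 (pdorder p).+1) big_mkord.
apply: eq_bigr => i _; rewrite big_allpairs big_map big_enum.
apply: eq_bigr => a _; rewrite big_map big_enum [RHS]/=.
by rewrite -big_mkcond.
Qed.

(** * The deconcatenation formula *)

Lemma rel_prod_ptens (K : fieldType) (f : nediag -> K) p q p' q' :
  pdle p p' -> pdle q q' ->
  rel_prod f (ptens p q) (ptens p' q') = rel_prod f p p' * rel_prod f q q'.
Proof. by move=> hp hq; rewrite /rel_prod relative_factors_ptens // big_cat.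
  Qed.

Lemma rel_prod_neq0 (K : fieldType) (f : nediag -> K) p :
  nonsingular f -> rel_prod f p p != 0.
Proof.
move=> hf; rewrite prodf_seq_neq0; apply/allP => a ha; apply/hf.
by have [+ _] := relative_factors_refl p; apply.
Qed.

(* Both sides run over the pairs [x] with [p <= x.1 (x) x.2]: such an [x] either
   comes from the diagram [x.1 (x) x.2] above [p], or lies componentwise above
   the unique splitting of [p] it induces. *)
Lemma sum_above_split (V : nmodType) p (F : pdiag * pdiag -> V) :
  \sum_(r <- above p) \sum_(x <- splits r) F x =
  \sum_(y <- splits p) \sum_(a <- above y.1) \sum_(b <- above y.2) F (a, b).
Proof.
have -> : \sum_(r <- above p) \sum_(x <- splits r) F x =
    \sum_(x <- [seq x | r <- above p, x <- splits r]) F x.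
  by rewrite big_allpairs_dep.
rewrite (_ : \sum_(y <- splits p) _ = \sum_(x <- [seq x | y <- splits p,
    x <- [seq (a, b) | a <- above y.1, b <- above y.2]]) F x); last first.
  by rewrite big_allpairs_dep; apply: eq_bigr => y _; rewrite big_allpairs.
apply: perm_big; apply: uniq_perm.
- apply: uniq_disjoint_union => [|r|r r' x _ _].
  + exact: above_uniq.
  + exact: splits_uniq.
  + by move=> /ptens_splits <- /ptens_splits <-.
- apply: uniq_disjoint_union => [|y|[a b] [c d] x].
  + exact: splits_uniq.
  + apply: allpairs_uniq; [exact: above_uniq|exact: above_uniq|].
    by move=> [a b] [c d].
  (* Two splittings of [p] with a common pair above them have left parts of equal order, since
     refinement preserves orders, and therefore coincide. *)
  move=> /ptens_splits /= <- /ptens_splits /= ec.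
  case/allpairsPdep=> z [w [ha _ ->]] /allpairsPdep[z' [w' [hc _ [ez _]]]].
  subst z'; move: ha hc; rewrite !mem_above.
  move=> /pdorder_pdle ea /pdorder_pdle hc.
  by have [|-> ->] := ptens_inj ec; first by rewrite ea hc.
move=> x; apply/allpairsPdep/allpairsPdep.
  case=> r [y [hr hy ->]]; move: hr hy;
    rewrite mem_above mem_splits => h /eqP er.
  move: h; rewrite -er => /pdle_ptens_split[p1 [p2 [ep h1 h2]]].
  exists (p1, p2), y; rewrite mem_splits ep eqxx; split=> //.
  by apply/allpairsPdep; exists y.1, y.2;
    rewrite !mem_above -surjective_pairing.
case=> y [z [hy /allpairsPdep[a [b [ha hb ->]]] ->]]; move: hy ha hb.
rewrite mem_splits !mem_above => /eqP<- ha hb.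
by exists (ptens a b), (a, b); rewrite mem_above mem_splits /= pdle_ptens.
Qed.

(** Expanding by linearity gives a double sum over diagrams above [p] and their splittings.
    [sum_above_split] regroups it by the splittings of [p], and multiplicativity of the coefficients
    separates the two tensor factors. *)
Lemma coproduct_sum_above (K : fieldType) (P : pdiag -> ParQSym K)
    (f : nediag -> K) p :
  (forall r, coproduct (P r) = sum_split r (fun a b => tensv (P a) (P b))) ->
  let Q q := sum_above q (fun r => rel_prod f q r *: P r) in
  coproduct (Q p) = sum_split p (fun a b => tensv (Q a) (Q b)).
Proof.
move=> hP Q.
have eQ q : Q q = \sum_(r <- above q) rel_prod f q r *: P r by apply: sum_aboveE.
rewrite sum_splitE eQ [LHS]linear_extension_sum.
rewrite (_ : \sum_(r <- above p) _ = \sum_(r <- above p) \sum_(x <- splits r)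
    rel_prod f p (ptens x.1 x.2) *: tensv (P x.1) (P x.2)); last first.
  apply: eq_bigr => r _; rewrite -[linear_extension _ _]/(coproduct (P r)) hP.
  rewrite sum_splitE scaler_sumr; apply: eq_big_seq => x.
  by rewrite mem_splits => /eqP->.
rewrite (sum_above_split p (fun x => rel_prod f p (ptens x.1 x.2) *:
  tensv (P x.1) (P x.2))); apply: eq_big_seq => y.
rewrite mem_splits => /eqP<-; rewrite !eQ tensv_sum.
apply: eq_big_seq => a; rewrite mem_above => ha.
apply: eq_big_seq => b; rewrite mem_above => hb.
by rewrite rel_prod_ptens.
Qed.

(** * Triangular change of basis over a finite poset *)

Section Triangular.
Variables (K : fieldType) (V : lmodType K) (I : finType) (U : V -> Prop).
Variables (le : rel I) (t : I -> I -> K) (x y : I -> V).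
Hypotheses (le_refl : reflexive le) (le_anti : antisymmetric le).
Hypothesis le_trans : transitive le.
Hypothesis t_neq0 : forall i, t i i != 0.
Hypothesis yE : forall i, y i = \sum_(j | le i j) t i j *: x j.

Lemma triangular_free :
  (forall c : I -> K, \sum_i c i *: x i = 0 -> forall i, c i = 0) ->
  forall c : I -> K, \sum_i c i *: y i = 0 -> forall i, c i = 0.
Proof.
move=> free_x c cy0.
(* This sum is the coefficient of [x j] after every [y i] is expanded. *)
have coef0 j : \sum_(i | le i j) c i * t i j = 0.
  apply: (free_x (fun j => \sum_(i | le i j) c i * t i j)); rewrite -[RHS]cy0.
  under eq_bigr => k _ do rewrite scaler_suml big_mkcond /=.
  rewrite exchange_big; apply: eq_bigr => i _ /=.
  rewrite yE scaler_sumr [RHS]big_mkcond; apply: eq_bigr => k _ /=.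
  by case: ifP => // _; rewrite scalerA.
(* Induction on the size of the down-set of [i]: in [coef0 i] the terms strictly below [i] vanish,
   leaving [c i * t i i]. *)
move=> i; have [n lt_n] := ubnP #|[set k | le k i]|.
elim: n i lt_n => // n IH i /ltnSE le_n; have := coef0 i.
rewrite (bigD1 i) //= big1 ?addr0 => [/eqP|k /andP[ki nki]].
  by rewrite mulf_eq0 (negPf (t_neq0 i)) orbF => /eqP.
rewrite IH ?mul0r //; apply: leq_trans le_n; apply: proper_card.
apply/properP; split; first by apply/subsetP => l; rewrite !inE => /le_trans;
  apply.
exists i; rewrite !inE ?le_refl //; apply: contraNN nki => ik.
by apply/eqP/le_anti; rewrite ki.
Qed.

(** Back substitution: solving [yE] for [x i] leaves only the [x j] with [j] strictly above [i],
    whose up-sets are strictly smaller. *)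
Lemma triangular_generates i : exists c : I -> K, x i = \sum_j c j *: y j.
Proof.
have [n lt_n] := ubnP #|[set k | le i k]|.
elim: n i lt_n => // n IH i /ltnSE le_n.
have spanD u v : (exists c : I -> K, u = \sum_j c j *: y j) ->
    (exists c : I -> K, v = \sum_j c j *: y j) ->
    exists c : I -> K, u + v = \sum_j c j *: y j.
  move=> [c ->] [d ->]; exists (fun j => c j + d j).
  by rewrite -big_split; apply: eq_bigr => j _; rewrite scalerDl.
have spanZ a u : (exists c : I -> K, u = \sum_j c j *: y j) ->
    exists c : I -> K, a *: u = \sum_j c j *: y j.
  move=> [c ->]; exists (fun j => a * c j).
  by rewrite scaler_sumr; apply: eq_bigr => j _; rewrite scalerA.
have -> : x i = (t i i)^-1 *: (y i + (-1) *: \sum_(j | le i j && (j != i)) t i j *: x j).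
  by rewrite yE (bigD1 i) //= scaleN1r addrK scalerA mulVf ?scale1r.
apply: (spanZ); apply: (spanD).
  exists (fun j => (j == i)%:R);
    rewrite (bigD1 i) //= eqxx scale1r big1 ?addr0 //.
  by move=> j /negPf->; rewrite scale0r.
apply: (spanZ); apply: (big_ind (fun v => exists c : I -> K, v = \sum_j c j *: y j)) => //.
  by exists (fun _ => 0); rewrite big1 // => j _; rewrite scale0r.
move=> j /andP[ij nji]; apply/spanZ/IH; apply: leq_trans le_n.
apply: proper_card; apply/properP; split.
  by apply/subsetP => l; rewrite !inE; apply: le_trans.
exists i; rewrite !inE ?le_refl //; apply: contraNN nji => ji.
by apply/eqP/le_anti; rewrite ji.
Qed.

(** The first hypothesis says that [U] contains the span of the [x i], which places each [y i] in
    [U]. *)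
Lemma triangular_basis :
  (forall c : I -> K, U (\sum_i c i *: x i)) ->
  is_basis_of U x -> is_basis_of U y.
Proof.
move=> Usum [_ free_x span_x]; split.
- move=> i; rewrite yE big_mkcond /=.
  rewrite (_ : \sum_j _ = \sum_j (if le i j then t i j else 0) *: x j) //.
  by apply: eq_bigr => j _; case: ifP; rewrite ?scale0r.
- exact: triangular_free.
move=> u /span_x[c ->]; have [d xE] := choice triangular_generates.
exists (fun j => \sum_i c i * d i j).
under eq_bigr => i _ do rewrite xE scaler_sumr.
rewrite exchange_big; apply: eq_bigr => j _; rewrite scaler_suml.
by apply: eq_bigr => i _; rewrite scalerA.
Qed.

End Triangular.

(** * Conclusion, one degree at a time *)

Lemma homogeneous_sum (K : fieldType) n (I : finType) (c : I -> K)
    (x : I -> ParQSym K) :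
  (forall i, homogeneous n (x i)) -> homogeneous n (\sum_i c i *: x i).
Proof.
move=> hx p hp; rewrite raddf_sum big1 // => i _.
by rewrite /= mcoeffZ hx // mulr0.
Qed.

Theorem proposition7p3 (K : fieldType) (P Q : pdiag -> ParQSym K)
    (hP : deconcatenation_basis P)
    (hQ : exists f : nediag -> K, nonsingular f /\
      forall p : pdiag, Q p = sum_above p (fun r => rel_prod f p r *: P r)) :
  deconcatenation_basis Q.
Proof.
case: hP hQ => [basisP coprodP] [f [f_ns QE]].
have -> : Q = fun q => sum_above q (fun r => rel_prod f q r *: P r).
  exact: functional_extensionality_dep.
split=> [n|p]; last exact: coproduct_sum_above.
have [homP _ _] := basisP n.
(* In degree [n], [pdorder (mkpd d)] computes to [n], so [sum_above] is by definition the triangular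
   sum over [diag n]. *)
apply: (triangular_basis (le := fun d d' => pdle (mkpd d) (mkpd d'))
  (t := fun d d' => rel_prod f (mkpd d) (mkpd d'))) (basisP n) => //.
- by move=> d; apply: pdle_refl.
- by move=> d d' /andP[h h']; apply/mkpd_inj/pdle_anti.
- by move=> d d' d''; apply: pdle_trans.
- by move=> d; apply: rel_prod_neq0.
- by move=> c; apply: homogeneous_sum.
Qed.
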